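(* Let $f:\Omega\to\mathbb H^3_1$ be a timelike immersion of a domain $\Omega\subset\mathbb R^2$ whose coordinates $(x,y)$ are null for the first fundamental form, with $2\langle f_x,f_y\rangle=\varepsilon e^\omega$, $\varepsilon=\pm1$, and with adapted frame $F$ and Gauss map $\nu=\mathrm{Ad}_Fe_3$. At every point of $\Omega$ the following are equivalent: (i) the Gaussian curvature of $f$ satisfies $K\ne0$; (ii) $\omega_{xy}\ne0$; (iii) $\nu$ is an immersion, that is, $\nu_x$ and $\nu_y$ are linearly independent.
   Context: Ambient space. On the space $\mathfrak{gl}(2,\mathbb R)$ of real $2\times2$ matrices let $\langle X,Y\rangle=-\tfrac12\operatorname{tr}(X\bar Y)$, where $\bar Y=(\operatorname{tr}Y)\mathrm{Id}-Y$; then $\langle X,X\rangle=-\det X$. Anti-de Sitter 3-space is $\mathbb H^3_1=\{X:\langle X,X\rangle=-1\}=SL(2,\mathbb R)$ with the induced Lorentzian metric (of constant curvature $-1$). Put $e_3=\begin{pmatrix}-1&0\\0&1\end{pmatrix}$, $\xi_1=\begin{pmatrix}0&0\\1&0\end{pmatrix}$, $\xi_2=\begin{pmatrix}0&1\\0&0\end{pmatrix}$, $\mathrm{Ad}_FX=FXF^{-1}$. All maps are smooth; a domain is a connected open set. An immersion $f$ is timelike if the induced metric $I$ is Lorentzian. Let $N$ be a unit normal ($\langle N,N\rangle=1$, $N$ orthogonal to $f,f_x,f_y$); the Gauss map is $\nu=f^{-1}N$, with values in $\mathbb S^2_1=\{X\in\mathfrak{sl}(2,\mathbb R):\langle X,X\rangle=1\}$.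 The coordinates being null means $\langle f_x,f_x\rangle=\langle f_y,f_y\rangle=0$. The second fundamental form $II$ has coefficients $\langle f_{xx},N\rangle,\langle f_{xy},N\rangle,\langle f_{yy},N\rangle$ and the Gaussian curvature is given by $K+1=\det II/\det I$. An adapted frame is a map $F:\Omega\to SL(2,\mathbb R)$ such that, for signs $\varepsilon_1,\varepsilon_2\in\{\pm1\}$ with $\varepsilon_1\varepsilon_2=\varepsilon$, $$f^{-1}f_x=\varepsilon_1e^{\omega/2}\mathrm{Ad}_F\xi_1,\qquad f^{-1}f_y=\varepsilon_2e^{\omega/2}\mathrm{Ad}_F\xi_2,\qquad N=f\,\mathrm{Ad}_Fe_3.$$ *)

(* Defs.v *)
From HB Require Import structures.
From mathcomp Require Import all_boot all_order all_algebra.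
From mathcomp Require Import all_classical all_reals all_analysis.

Set Implicit Arguments.
Unset Strict Implicit.
Unset Printing Implicit Defensive.

Import Order.TTheory GRing.Theory Num.Theory.
Import numFieldNormedType.Exports.

Local Open Scope classical_set_scope.
Local Open Scope ring_scope.

Section Smooth.
Context {R : realType} {V W : normedModType R}.

Fixpoint Ck (k : nat) (A : set V) (g : V -> W) : Prop :=
  if k is k'.+1 then
    (forall p, A p -> differentiable g p) /\ (forall v, Ck k' A ('D_v g))
  else forall p, A p -> {for p, continuous g}.

(* Only used with A open: maps on A are represented by total functions whose
   values outside of A are irrelevant. *)
Definition smooth_on (A : set V) (g : V -> W) : Prop := forall k, Ck k A g.

End Smooth.

Section Plane.
Context {R : realType}.

Definition domain (A : set (R * R)%type) : Prop := open A /\ connected A.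

Definition partial_x {W : normedModType R} (g : R * R -> W) : R * R -> W :=
  'D_((1, 0) : R * R) g.

Definition partial_y {W : normedModType R} (g : R * R -> W) : R * R -> W :=
  'D_((0, 1) : R * R) g.

Definition immersion_at (g : R * R -> 'M[R]_2) (p : R * R) : Prop :=
  free [:: partial_x g p; partial_y g p].

Definition is_sign (e : R) : Prop := e = 1 \/ e = -1.

End Plane.

Section AntiDeSitter.
Context {R : realType}.
Implicit Types (X Y : 'M[R]_2) (A : set (R * R)%type).

Definition mx22 (a b c d : R) : 'M[R]_2 :=
  \matrix_(i < 2, j < 2)
    if i == 0 then (if j == 0 then a else b) else (if j == 0 then c else d).

Definition e3 : 'M[R]_2 := mx22 (-1) 0 0 1.
Definition xi1 : 'M[R]_2 := mx22 0 0 1 0.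
Definition xi2 : 'M[R]_2 := mx22 0 1 0 0.

Definition bar_mx Y : 'M[R]_2 := (\tr Y)%:M - Y.

Definition dotM X Y : R := - (\tr (X *m bar_mx Y) / 2).

Definition AdS3 : set 'M[R]_2 := [set X | dotM X X = -1].

Definition SL2 : set 'M[R]_2 := [set X | \det X = 1].

Definition Ad (G X : 'M[R]_2) : 'M[R]_2 := G *m X *m invmx G.

Definition I_form (f : R * R -> 'M[R]_2) (p u v : R * R) : R :=
  dotM ('D_u f p) ('D_v f p).

(* Signature (1, 1): there is an orthonormal basis with one spacelike and one
   timelike vector (linear independence of u and v is automatic). *)
Definition lorentzian (b : R * R -> R * R -> R) : Prop :=
  exists u v, [/\ b u u = 1, b v v = -1 & b u v = 0].

Definition timelike_immersion A (f : R * R -> 'M[R]_2) : Prop :=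
  [/\ smooth_on A f,
      forall p, A p -> AdS3 (f p),
      forall p, A p -> immersion_at f p &
      forall p, A p -> lorentzian (I_form f p)].

Definition null_coordinates A (f : R * R -> 'M[R]_2) : Prop :=
  forall p, A p ->
    dotM (partial_x f p) (partial_x f p) = 0 /\
    dotM (partial_y f p) (partial_y f p) = 0.

Definition unit_normal A (f N : R * R -> 'M[R]_2) : Prop :=
  smooth_on A N /\
  forall p, A p ->
    [/\ dotM (N p) (N p) = 1,
        dotM (N p) (f p) = 0,
        dotM (N p) (partial_x f p) = 0 &
        dotM (N p) (partial_y f p) = 0].

Definition gauss_map (f N : R * R -> 'M[R]_2) (p : R * R) : 'M[R]_2 :=
  invmx (f p) *m N p.

Definition I_mx (f : R * R -> 'M[R]_2) (p : R * R) : 'M[R]_2 :=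
  let fx := partial_x f p in
  let fy := partial_y f p in
  mx22 (dotM fx fx) (dotM fx fy) (dotM fx fy) (dotM fy fy).

Definition II_mx (f N : R * R -> 'M[R]_2) (p : R * R) : 'M[R]_2 :=
  let fxx := partial_x (partial_x f) p in
  let fxy := partial_y (partial_x f) p in
  let fyy := partial_y (partial_y f) p in
  mx22 (dotM fxx (N p)) (dotM fxy (N p)) (dotM fxy (N p)) (dotM fyy (N p)).

(* Gauss equation in curvature -1: K + 1 = det II / det I. *)
Definition gauss_curvature (f N : R * R -> 'M[R]_2) (p : R * R) : R :=
  \det (II_mx f N p) / \det (I_mx f p) - 1.

Definition adapted_frame A (f N : R * R -> 'M[R]_2) (omega : R * R -> R)
    (eps : R) (F : R * R -> 'M[R]_2) : Prop :=
  [/\ smooth_on A F,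
      forall p, A p -> SL2 (F p) &
      exists eps1 eps2 : R,
        [/\ is_sign eps1, is_sign eps2, eps1 * eps2 = eps &
            forall p, A p ->
            [/\ invmx (f p) *m partial_x f p
                  = (eps1 * expR (omega p / 2)) *: Ad (F p) xi1,
                invmx (f p) *m partial_y f p
                  = (eps2 * expR (omega p / 2)) *: Ad (F p) xi2 &
                N p = f p *m Ad (F p) e3]]].

End AntiDeSitter.

(* Main.v *)
(* Write F_x = F U and F_y = F W with U, W in sl(2); let u2, u3 and w2, w3 be
   their off-diagonal entries, a = eps1 e^(omega/2) and b = eps2 e^(omega/2).
   Equality of the mixed derivatives of f forces U_11 = - omega_x / 4,
   W_11 = omega_y / 4 and a b + a w2 + b u3 = 0.  The diagonal of the
   Maurer-Cartan equation U_y - W_x = [U, W] then reads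
   omega_xy = - 2 D with D = u2 w3 - w2 u3, while the coefficients of II give
   K = 4 D / (a b).  Finally nu_x = Ad_F [U, e3] and nu_y = Ad_F [W, e3] have
   off-diagonal parts 2 (u2, - u3) and 2 (w2, - w3), so they are independent iff
   D <> 0. *)
Require Import Defs.
From mathcomp Require Import all_boot all_order all_algebra.
From mathcomp Require Import all_classical all_reals all_analysis.
From mathcomp Require Import ring lra.
Import Order.TTheory GRing.Theory Num.Theory.
Import numFieldNormedType.Exports.
Local Open Scope classical_set_scope.
Local Open Scope ring_scope.

(** * Derivatives and their symmetry *)

(** The two difference quotients are the same function of the increment. Derivatives along [v] thus
    reduce to derivatives in one real variable. *)
Lemma is_derive_lineE (R : realType) (V W : normedModType R) (f : V -> W)
  (x v : V) (s : R) (df : W) :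
  is_derive s 1 (fun h : R => f (h *: v + x)) df =
  is_derive (s *: v + x) v f df.
Proof.
suff E : (fun h : R => h^-1 *: (((fun h => f (h *: v + x)) \o shift s) (h *: 1)
                                - f (s *: v + x))) =
         (fun h : R => h^-1 *: ((f \o shift (s *: v + x)) (h *: v)
                                - f (s *: v + x))).
  apply/propext; split=> -[]; rewrite /derivable /derive => h1 h2;
  by constructor; rewrite /derivable /derive; rewrite ?E // -?E.
apply/funext => h /=.
by rewrite [h *: 1]mulr1 scalerDl addrA.
Qed.

Lemma is_derive_exp (R : realType) (V : normedModType R) (g : V -> R)
  (x v : V) (dg : R) :
  is_derive x v g dg -> is_derive x v (fun q => expR (g q)) (expR (g x) * dg).
Proof.
(* Writing [x] as [0 *: v + x] puts it on a line, where the one-variable chain rule applies. *)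
rewrite -[x]add0r -[X in X + x](scale0r v) -!is_derive_lineE => h.
by apply: is_derive1_comp.
Qed.

(** The mean value theorem along [v] turns the mixed difference into [t] times a difference of two
    values of [h]. The first-order expansion of [h] at [p] leaves an error o(t) there, hence o(t^2)
    in all. *)
Lemma mixed_difference (R : realType) (V : normedModType R) (g h : V -> R)
  (p v w : V) (e : R) : 0 < e ->
  (\forall q \near p, is_derive q v g (h q)) -> differentiable h p ->
  \forall t \near 0^'+,
    `|g (t *: v + t *: w + p) - g (t *: v + p) - (g (t *: w + p) - g p)
      - t ^+ 2 * 'D_w h p| <= e * t ^+ 2.
Proof.
move=> e0 dg dh.
(* Up to the factor [t], the two points used lie within |v| + |w| and |v| of [p]; [C] exceeds the
   sum of these bounds, and the 1 keeps it positive. *)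
set C := 2 * `|v| + `|w| + 1.
have C0 : 0 < C by rewrite /C; have := normr_ge0 v; have := normr_ge0 w; lra.
have hL := diff_locally dh.
have /eqaddoP/(_ (e / C)) := hL.
rewrite divr_gt0// => /(_ isT) hlin.
have dg0 : \forall z \near (0 : V), is_derive (z + p) v g (h (z + p)).
  by move/nbhs0P: dg; apply: filterS => z; rewrite addrC.
have [d /= d0 hd] : exists2 d, 0 < d &
    forall z, ball (0 : V) d z ->
      `|h (z + p) - h p - 'd h p z| <= e / C * `|z| /\
      is_derive (z + p) v g (h (z + p)).
  apply/nbhs_ballP; apply: filterI dg0; apply: filterS hlin => z /=.
  by rewrite opprD addrA.
near=> t.
have t0 : 0 < t by near: t; exact: nbhs_right_gt.
have td : t * C < d.
  by rewrite -ltr_pdivlMr//; near: t; apply: nbhs_right_lt; rewrite divr_gt0.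
(* The boolean [b] treats the points with and without the shift [t *: w] at once. *)
have bnd (s : R) (b : bool) : 0 <= s <= t ->
    `|s *: v + b%:R *: (t *: w)| <= t * (`|v| + b%:R * `|w|).
  move=> /andP[s0 st]; rewrite (le_trans (ler_normD _ _))//.
  rewrite !normrZ (ger0_norm s0) (gtr0_norm t0) (ger0_norm (ler0n _ _)).
  have : s * `|v| <= t * `|v| by rewrite ler_wpM2r.
  by lra.
have inb (s : R) (b : bool) : 0 <= s <= t ->
    ball (0 : V) d (s *: v + b%:R *: (t *: w)).
  move=> st; rewrite -ball_normE /= sub0r normrN.
  apply: le_lt_trans (bnd s b st) _; apply: le_lt_trans td.
  rewrite ler_pM2l// /C; have := normr_ge0 v; have := normr_ge0 w.
  by case: b => /=; lra.
have lin (s : R) (b : bool) : 0 <= s <= t ->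
   `|h (s *: v + b%:R *: (t *: w) + p) - h p
     - 'd h p (s *: v + b%:R *: (t *: w))|
     <= e / C * (t * (`|v| + b%:R * `|w|)).
  move=> st; have [/= H _] := hd _ (inb s b st).
  apply: le_trans H _.
  by rewrite ler_wpM2l ?bnd// divr_ge0// ltW.
pose phi (s : R) := g (s *: v + (t *: w + p)) - g (s *: v + p).
have dphi (s : R) : 0 <= s <= t ->
    is_derive s 1 phi (h (s *: v + (t *: w + p)) - h (s *: v + p)).
  move=> st.
  have := inb s true st; have := inb s false st.
  rewrite !scale1r !scale0r addr0 => /hd[_ /= D0] /hd[_ /= D1].
  by apply: is_deriveB; rewrite is_derive_lineE // addrA.
have [c ct phiE] : exists2 c, c \in `]0, t[%R &
    phi t - phi 0 = (h (c *: v + (t *: w + p)) - h (c *: v + p)) * (t - 0).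
  apply: (MVT (df := fun s => h (s *: v + (t *: w + p)) - h (s *: v + p))) => //.
    by move=> s; rewrite in_itv/= => /andP[s0 st]; apply: dphi; rewrite !ltW.
  apply: derivable_within_continuous => s; rewrite in_itv/= => st.
  by have [] := dphi _ st.
have c01 : 0 <= c <= t by move: ct; rewrite in_itv/= => /andP[? ?]; rewrite !ltW.
have := lin c true c01; have := lin c false c01.
rewrite !scale1r !scale0r !addr0 -[c *: v + t *: w + p]addrA.
move: phiE; rewrite /phi !scale0r !add0r subr0.
rewrite [t *: v + (t *: w + p)]addrA => -> {}.
(* By linearity the terms in the unknown [c] cancel between the two expansions, and [t * 'D_w h p]
   remains. *)
have -> : 'd h p (c *: v + t *: w) = 'd h p (c *: v) + t * 'D_w h p.
  by rewrite linearD [X in _ + X]linearZ /= deriveE.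
move=> H0 H1.
set A := h (c *: v + (t *: w + p)) in H1 *; set B := h (c *: v + p) in H0 *.
set L := 'd h p _ in H0 H1; set D := 'D_w h p in H1 *.
have -> : (A - B) * t - t ^+ 2 * D = t * ((A - h p - (L + t * D)) - (B - h p - L)).
  by ring.
rewrite normrM (gtr0_norm t0) expr2 [leRHS]mulrCA ler_pM2l//.
apply: le_trans (ler_normB _ _) _.
apply: le_trans (lerD H1 H0) _.
rewrite -mulrDr -mulrDr mul1r mul0r addr0.
rewrite [leRHS](_ : _ = e / C * (t * C)); last by field; rewrite gt_eqF.
rewrite ler_pM2l ?divr_gt0// ler_pM2l// /C; lra.
Unshelve. all: by end_near. Qed.

(* Both sides are the limit of the mixed difference quotient, which is
   symmetric in v and w; the continuity of second derivatives is not needed. *)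
Lemma deriveC (R : realType) (V : normedModType R) (g h k : V -> R)
  (p v w : V) :
  (\forall q \near p, is_derive q v g (h q)) ->
  (\forall q \near p, is_derive q w g (k q)) ->
  differentiable h p -> differentiable k p -> 'D_w h p = 'D_v k p.
Proof.
move=> gh gk dh dk; apply/eqP; rewrite -subr_eq0 -normr_le0.
apply/ler_addgt0Pl => e e0; rewrite addr0.
have e2 : 0 < e / 2 by rewrite divr_gt0.
have D1 := mixed_difference R V g h p v w _ e2 gh dh.
have D2 := mixed_difference R V g k p w v _ e2 gk dk.
(* Both estimates hold at a common [t > 0] and concern the same mixed difference, up to the order of
   its terms. *)
have [t [[]]] := filter_ex (filterI (filterI D1 D2) (nbhs_right_gt (0 : R))).
rewrite [t *: w + t *: v]addrC.
set A := 'D_w h p; set B := 'D_v k p.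
move=> H1 H2 /= t0.
have t20 : 0 < t ^+ 2 by rewrite exprn_gt0.
rewrite -(ler_pM2l t20) -[X in X * `|_|](gtr0_norm t20) -normrM.
rewrite [leRHS](_ : _ = e / 2 * t ^+ 2 + e / 2 * t ^+ 2); last by field.
apply: le_trans (lerD H2 H1).
rewrite -[leRHS]/(`|_| + `|_|) (le_trans _ (ler_normB _ _))//.
rewrite le_eqVlt; apply/orP; left; apply/eqP; congr (`|_|); ring.
Qed.

(** * Derivatives of matrix-valued maps *)

Section MatrixDerivatives.
Context (R : realType) (V : normedModType R).
Implicit Types (p v : V).

Lemma is_derive_mxP m n (M : V -> 'M[R]_(m, n)) p v dM :
  is_derive p v M dM <->
  forall i j, is_derive p v (fun q => M q i j) (dM i j).
Proof.
split=> [[Mv <-] i j|Mv].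
  rewrite derive_mx// mxE; apply: derivableP.
  exact: (derivable_mxP _ _ _).1.
have Md : derivable M p v by apply/derivable_mxP => i j; have [] := Mv i j.
apply: DeriveDef => //; rewrite derive_mx//.
by apply/matrixP => i j; rewrite mxE; have [] := Mv i j.
Qed.

Lemma is_derive_mulmx m n k (A : V -> 'M[R]_(m, n)) (B : V -> 'M[R]_(n, k))
  p v dA dB : is_derive p v A dA -> is_derive p v B dB ->
  is_derive p v (fun q => A q *m B q) (dA *m B p + A p *m dB).
Proof.
move=> /is_derive_mxP Av /is_derive_mxP Bv; apply/is_derive_mxP => i j.
rewrite !mxE -big_split /=.
rewrite [X in is_derive _ _ X](_ : _ =
  \sum_(l < n) ((fun q => A q i l) * (fun q => B q l j))); last first.
  by apply/funext => q; rewrite mxE fct_sumE.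
apply: is_derive_sum => l.
apply: is_derive_eq.
by rewrite addrC; congr (_ + _); rewrite /GRing.scale /= mulrC.
Qed.

Lemma is_derive_scalemx m n (a : V -> R) (A : V -> 'M[R]_(m, n)) p v da dA :
  is_derive p v a da -> is_derive p v A dA ->
  is_derive p v (fun q => a q *: A q) (da *: A p + a p *: dA).
Proof.
move=> av /is_derive_mxP Av; apply/is_derive_mxP => i j.
rewrite !mxE.
rewrite [X in is_derive _ _ X](_ : _ = a * (fun q => A q i j)); last first.
  by apply/funext => q; rewrite mxE.
apply: is_derive_eq.
by rewrite addrC; congr (_ + _); rewrite /GRing.scale /= mulrC.
Qed.

Lemma is_derive_bar_mx (A : V -> 'M[R]_2) p v dA :
  is_derive p v A dA -> is_derive p v (fun q => bar_mx (A q)) (bar_mx dA).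
Proof.
move=> /is_derive_mxP Av; apply/is_derive_mxP => i j; rewrite !mxE.
rewrite [X in is_derive _ _ X](_ : _ =
  (\sum_(l < 2) (fun q => A q l l)) *+ (i == j) - (fun q => A q i j)); last first.
  apply/funext => q; rewrite !mxE /=; congr (_ - _).
  by case: (i == j); rewrite ?mulr0n // !mulr1n fct_sumE.
apply: is_deriveB; case: (i == j); rewrite ?mulr0n ?mulr1n //.
  exact: is_derive_sum.
exact: is_derive_cst.
Qed.

Lemma mx_deriveC m n (M : V -> 'M[R]_(m, n)) p v w :
  (\forall q \near p, differentiable M q) ->
  differentiable ('D_v M) p -> differentiable ('D_w M) p ->
  'D_w ('D_v M) p = 'D_v ('D_w M) p.
Proof.
move=> dM dv dw; apply/matrixP => i j.
have entry (N : V -> 'M[R]_(m, n)) :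
    differentiable N p -> differentiable (fun q => N q i j) p.
  by move=> dN; exact: (differentiable_comp dN (differentiable_coord _ i j)).
have near_derive u : \forall q \near p,
    is_derive q u (fun q => M q i j) (('D_u M q) i j).
  apply: filterS dM => q dq; move: i j {entry}; apply/is_derive_mxP.
  exact/derivableP/diff_derivable.
have D u (N : V -> 'M[R]_(m, n)) : 
    differentiable N p -> 'D_u N p i j = 'D_u (fun q => N q i j) p.
  by move=> dN; rewrite derive_mx ?mxE//; apply: diff_derivable.
have C := deriveC _ _ _ _ _ _ _ _ (near_derive v) (near_derive w)
  (entry _ dv) (entry _ dw).
exact: etrans (D w _ dv) (etrans C (esym (D v _ dw))).
Qed.

End MatrixDerivatives.

(** * Real 2 x 2 matrices *)

Section TwoByTwo.
Context {R : realType}.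
Implicit Types (X Y P Q : 'M[R]_2) (a b c d : R).

Lemma ord2P (i : 'I_2) : i = 0 \/ i = 1.
Proof. by case: i => [[|[|//]] ?]; [left|right]; exact: val_inj. Qed.

Lemma mx22_eta X : X = mx22 (X 0 0) (X 0 1) (X 1 0) (X 1 1).
Proof.
by apply/matrixP => i j; rewrite mxE; case: (ord2P i) => ->; case: (ord2P j) => ->.
Qed.

Lemma mx22_inj a b c d a' b' c' d' :
  mx22 a b c d = mx22 a' b' c' d' -> [/\ a = a', b = b', c = c' & d = d'].
Proof.
move=> E; have e i j := congr1 (fun X : 'M[R]_2 => X i j) E.
by move: (e 0 0) (e 0 1) (e 1 0) (e 1 1); rewrite !mxE.
Qed.

Lemma mx22D a b c d a' b' c' d' :
  mx22 a b c d + mx22 a' b' c' d' = mx22 (a + a') (b + b') (c + c') (d + d').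
Proof. by rewrite [LHS]mx22_eta !mxE. Qed.

Lemma mx22N a b c d : - mx22 a b c d = mx22 (- a) (- b) (- c) (- d).
Proof. by rewrite [LHS]mx22_eta !mxE. Qed.

Lemma mx22Z k a b c d : k *: mx22 a b c d = mx22 (k * a) (k * b) (k * c) (k * d).
Proof. by rewrite [LHS]mx22_eta !mxE. Qed.

Lemma mx22M a b c d a' b' c' d' :
  mx22 a b c d *m mx22 a' b' c' d' =
  mx22 (a * a' + b * c') (a * b' + b * d') (c * a' + d * c') (c * b' + d * d').
Proof. by rewrite [LHS]mx22_eta !mxE !big_ord_recl !big_ord0 !mxE /= !addr0. Qed.

Lemma mx22_scalar a : a%:M = mx22 a 0 0 a.
Proof. by rewrite [LHS]mx22_eta !mxE. Qed.

Lemma mx22_tr a b c d : \tr (mx22 a b c d) = a + d.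
Proof. by rewrite /mxtrace !big_ord_recl big_ord0 !mxE /= addr0. Qed.

Lemma mx22_det a b c d : \det (mx22 a b c d) = a * d - b * c.
Proof.
rewrite (expand_det_row _ 0) !big_ord_recl big_ord0 /cofactor !det_mx11 !mxE /=.
by rewrite expr0 expr1 mul1r mulN1r mulrN addr0.
Qed.

Lemma mx22_bar a b c d : bar_mx (mx22 a b c d) = mx22 d (- b) (- c) a.
Proof.
rewrite /bar_mx mx22_tr mx22_scalar mx22N mx22D; congr mx22; ring.
Qed.

Definition mx22E := (mx22D, mx22N, mx22Z, mx22M, mx22_bar, mx22_tr, mx22_det).

(** Used as an elimination principle, this reduces matrix identities to polynomial identities in the
    entries. *)
Lemma mx22_ind (T : 'M[R]_2 -> Prop) :
  (forall a b c d, T (mx22 a b c d)) -> forall X, T X.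
Proof. by move=> Tabcd X; rewrite [X]mx22_eta. Qed.

Lemma bar_mxK X : bar_mx (bar_mx X) = X.
Proof. by elim/mx22_ind: X => *; rewrite !mx22_bar !opprK. Qed.

Lemma bar_mxM X Y : bar_mx (X *m Y) = bar_mx Y *m bar_mx X.
Proof.
elim/mx22_ind: X => a b c d; elim/mx22_ind: Y => a' b' c' d'.
by rewrite !mx22E; congr mx22; ring.
Qed.

Lemma mulmx_bar X : X *m bar_mx X = (\det X)%:M.
Proof.
elim/mx22_ind: X => a b c d; rewrite !mx22E mx22_scalar.
by congr mx22; ring.
Qed.

Lemma bar_mulmx X : bar_mx X *m X = (\det X)%:M.
Proof.
elim/mx22_ind: X => a b c d; rewrite !mx22E mx22_scalar.
by congr mx22; ring.
Qed.

(** The hypothesis is the derivative of P bar(P) = 1 in the direction [X]; multiplying it by bar(P)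
    on the left and by [P] on the right gives the claim. Since bar(Y) = -Y means tr Y = 0, this
    places P^-1 X in sl(2). *)
Lemma bar_mx_tangent P X : SL2 P ->
  X *m bar_mx P + P *m bar_mx X = 0 ->
  bar_mx (bar_mx P *m X) = - (bar_mx P *m X).
Proof.
move=> SP; have BP : bar_mx P *m P = 1%:M by rewrite bar_mulmx SP.
rewrite bar_mxM bar_mxK; move: (bar_mx P) (bar_mx X) BP => B C BP.
move/(congr1 (fun Y => B *m (Y *m P))).
rewrite mul0mx mulmx0 mulmxDl mulmxDr -mulmxA BP mulmx1.
rewrite -(mulmxA P) mulmxA BP mul1mx => /eqP.
by rewrite addrC addr_eq0 => /eqP.
Qed.

Lemma AdS3_det X : AdS3 X -> \det X = 1.
Proof. by rewrite /AdS3 /dotM /= mulmx_bar mxtrace_scalar -mulr_natr; lra. Qed.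

Lemma SL2_unit P : SL2 P -> P \in unitmx.
Proof. by move=> detP; rewrite unitmxE detP unitr1. Qed.

(** This makes the inverse linear in the entries, hence easy to differentiate. *)
Lemma invmx_SL2 P : SL2 P -> invmx P = bar_mx P.
Proof.
move=> detP; apply: (can_inj (mulKmx (SL2_unit P detP))).
by rewrite mulmxV ?SL2_unit// mulmx_bar detP.
Qed.

Lemma AdM P X Y : SL2 P -> Ad P (X *m Y) = Ad P X *m Ad P Y.
Proof. by move=> /SL2_unit uP; rewrite /Ad !mulmxA mulmxKV. Qed.

Lemma AdD P X Y : Ad P (X + Y) = Ad P X + Ad P Y.
Proof. by rewrite /Ad mulmxDr mulmxDl. Qed.

Lemma AdZ P (k : R) X : Ad P (k *: X) = k *: Ad P X.
Proof. by rewrite /Ad -scalemxAr -scalemxAl. Qed.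

(** The left side is what the product rule yields for a P Ad_Q X, where [P *m Ad Q Y] is the
    derivative of [P] and [Ad Q Z] that of Ad_Q X; it is collected here into frame coordinates. *)
Lemma scaled_Ad_leibniz P Q X Y Z (da a : R) : SL2 Q ->
  da *: (P *m Ad Q X) + a *: (P *m Ad Q Y *m Ad Q X + P *m Ad Q Z) =
  P *m Ad Q (da *: X + a *: (Y *m X + Z)).
Proof.
move=> SQ; rewrite AdD !AdZ AdD (AdM _ _ _ SQ).
by rewrite mulmxDr -!scalemxAr mulmxDr (mulmxA P (Ad Q Y)).
Qed.

Lemma Ad_inj P : SL2 P -> injective (Ad P).
Proof.
move=> /SL2_unit uP X Y /(congr1 (mulmxr P)) /=; rewrite !mulmxKV//.
by move/(can_inj (mulKmx uP)).
Qed.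

(** Left multiplication by [P] and conjugation by [Q] are isometries: bar(P) P = bar(Q) Q = 1 and
    the trace is cyclic. Scalar products can therefore be computed in the frame. *)
Lemma dotM_Ad P Q X Y : \det P = 1 -> SL2 Q ->
  dotM (P *m Ad Q X) (P *m Ad Q Y) = dotM X Y.
Proof.
move=> detP SQ; rewrite /dotM /Ad.
rewrite !(bar_mxM, invmx_SL2 Q SQ) bar_mxK.
have QQ : bar_mx Q *m Q = 1%:M by rewrite bar_mulmx SQ.
rewrite -mulmxA mxtrace_mulC -!mulmxA bar_mulmx detP mulmx1.
by rewrite (mulmxA (bar_mx Q)) QQ mul1mx mxtrace_mulC -!mulmxA QQ mulmx1.
Qed.

End TwoByTwo.

(** * Moving frames *)

Section MovingFrame.
Context {R : realType} {V : normedModType R}.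
Implicit Types (A : set V) (F f : V -> 'M[R]_2) (p v w : V).

Lemma smooth_on_differentiable {W : normedModType R} A (g : V -> W) p :
  smooth_on A g -> A p -> differentiable g p.
Proof. by move=> /(_ 1%N)[dg _] /dg. Qed.

Lemma smooth_on_derive {W : normedModType R} A (g : V -> W) v :
  smooth_on A g -> smooth_on A ('D_v g).
Proof. by move=> sg k; have [_] := sg k.+1; apply. Qed.

Lemma smooth_on_is_derive {W : normedModType R} A (g : V -> W) p v :
  smooth_on A g -> A p -> is_derive p v g ('D_v g p).
Proof.
by move=> sg Ap; exact/derivableP/diff_derivable/(smooth_on_differentiable A).
Qed.

(** On [SL2] this is F^-1 dF(v), with [bar_mx] standing for the inverse. *)
Definition maurer_cartan F v p : 'M[R]_2 := bar_mx (F p) *m 'D_v F p.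

Lemma derive_maurer_cartan F v p :
  SL2 (F p) -> 'D_v F p = F p *m maurer_cartan F v p.
Proof. by move=> SF; rewrite mulmxA mulmx_bar SF mul1mx. Qed.

Context (A : set V) (oA : open A).

Lemma near_open p : A p -> \forall q \near p, A q.
Proof. by move=> Ap; exact: open_nbhs_nbhs. Qed.

Context (F : V -> 'M[R]_2) (smF : smooth_on A F).
Context (SF : forall p, A p -> SL2 (F p)).

Lemma maurer_cartan_sl2 v p : A p ->
  bar_mx (maurer_cartan F v p) = - maurer_cartan F v p.
Proof.
move=> Ap; have dF := smooth_on_is_derive A F p v smF Ap.
have D := is_derive_mulmx _ _ _ _ _ _ _ _ _ _ _ dF
  (is_derive_bar_mx _ _ _ _ _ _ dF).
have : is_derive p v (fun q => F q *m bar_mx (F q)) 0.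
  (* F bar(F) is constantly 1 near [p], so its derivative vanishes. *)
  apply: near_eq_is_derive (is_derive_cst (1%:M : 'M[R]_2) p v).
  by apply: filterS (near_open p Ap) => q /SF Sq; rewrite mulmx_bar Sq.
move=> [_]; have [_ ->] := D => E.
exact: bar_mx_tangent (SF p Ap) E.
Qed.

(** Product rule for F X bar(F): the derivative of bar(F) contributes the bar of the Maurer-Cartan
    matrix, which is its negative, whence the commutator. *)
Lemma is_derive_Ad X v p : A p ->
  is_derive p v (fun q => Ad (F q) X)
    (Ad (F p) (maurer_cartan F v p *m X - X *m maurer_cartan F v p)).
Proof.
move=> Ap; have dF := smooth_on_is_derive A F p v smF Ap.
have dX := is_derive_mulmx _ _ _ _ _ _ _ _ _ _ _ dF (is_derive_cst X p v).
have D := is_derive_mulmx _ _ _ _ _ _ _ _ _ _ _ dX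
  (is_derive_bar_mx _ _ _ _ _ _ dF).
apply: near_eq_is_derive.
  apply: filterS (near_open p Ap) => q /SF Sq; rewrite /Ad (invmx_SL2 _ Sq).
  reflexivity.
apply: is_derive_eq D _.
rewrite /= mulmx0 addr0 /Ad (invmx_SL2 _ (SF p Ap)).
rewrite (mulmxBr (F p) (maurer_cartan F v p *m X)) mulmxBl.
rewrite (derive_maurer_cartan _ _ _ (SF p Ap)) bar_mxM maurer_cartan_sl2//.
by rewrite mulNmx mulmxN !mulmxA.
Qed.

Lemma is_derive_scaled_Ad f (a : V -> R) X Y v p da : A p ->
  is_derive p v a da -> is_derive p v f (f p *m Ad (F p) Y) ->
  is_derive p v (fun q => a q *: (f q *m Ad (F q) X))
    (f p *m Ad (F p) (da *: X + a p *: (Y *m X +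
      (maurer_cartan F v p *m X - X *m maurer_cartan F v p)))).
Proof.
move=> Ap av fv.
have := is_derive_scalemx _ _ _ _ _ _ _ _ _ _ av
  (is_derive_mulmx _ _ _ _ _ _ _ _ _ _ _ fv (is_derive_Ad X v p Ap)).
move=> D; apply: is_derive_eq D _.
exact: scaled_Ad_leibniz (SF p Ap).
Qed.

(** The quadratic term comes from the derivative of F^-1, namely - F^-1 F_w F^-1. *)
Lemma is_derive_maurer_cartan v w p : A p ->
  is_derive p w (maurer_cartan F v)
    (bar_mx (F p) *m 'D_w ('D_v F) p
     - maurer_cartan F w p *m maurer_cartan F v p).
Proof.
move=> Ap; have dF := smooth_on_is_derive A F p w smF Ap.
have dvF := smooth_on_is_derive A _ p w (smooth_on_derive A F v smF) Ap.
have := is_derive_mulmx _ _ _ _ _ _ _ _ _ _ _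
  (is_derive_bar_mx _ _ _ _ _ _ dF) dvF.
move=> D; apply: is_derive_eq D _; rewrite addrC; congr (_ + _).
rewrite (derive_maurer_cartan _ _ _ (SF p Ap)) bar_mxM maurer_cartan_sl2//.
by rewrite !mulNmx -mulmxA.
Qed.

Lemma smooth_on_mx_deriveC m n (g : V -> 'M[R]_(m, n)) v w p :
  smooth_on A g -> A p -> 'D_w ('D_v g) p = 'D_v ('D_w g) p.
Proof.
move=> sg Ap; apply: mx_deriveC.
- by apply: filterS (near_open p Ap) => q; exact: smooth_on_differentiable.
- exact: smooth_on_differentiable (smooth_on_derive A g v sg) Ap.
- exact: smooth_on_differentiable (smooth_on_derive A g w sg) Ap.
Qed.

(** The second derivatives of [F] cancel by symmetry, and only the quadratic terms survive. *)
Lemma maurer_cartan_eq v w p : A p ->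
  'D_w (maurer_cartan F v) p - 'D_v (maurer_cartan F w) p =
  maurer_cartan F v p *m maurer_cartan F w p
  - maurer_cartan F w p *m maurer_cartan F v p.
Proof.
move=> Ap.
have [_ ->] := is_derive_maurer_cartan v w p Ap.
have [_ ->] := is_derive_maurer_cartan w v p Ap.
rewrite (smooth_on_mx_deriveC _ _ _ v w p smF Ap).
by rewrite opprB addrC addrA addrNK.
Qed.

(** All second derivatives of the immersion are instances of this formula, with [X] and [Y] among
    [xi1] and [xi2]. *)
Lemma derive2_frame f (a : V -> R) (b : R) X Y v w p da : A p ->
  (forall q, A q -> 'D_v f q = a q *: (f q *m Ad (F q) X)) ->
  is_derive p w f (b *: (f p *m Ad (F p) Y)) -> is_derive p w a da ->
  'D_w ('D_v f) p = f p *m Ad (F p) (da *: X + a p *: ((b *: Y) *m X +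
      (maurer_cartan F w p *m X - X *m maurer_cartan F w p))).
Proof.
move=> Ap fv fw aw.
have fw' : is_derive p w f (f p *m Ad (F p) (b *: Y)).
  by rewrite AdZ -scalemxAr.
have [_ <-] := is_derive_scaled_Ad f a X _ w p da Ap aw fw'.
apply: near_eq_derive; apply: filterS (near_open p Ap) => q Aq; exact: fv.
Qed.

End MovingFrame.

(** * Null coordinates on surfaces in anti-de Sitter space *)

Section AdaptedFrame.
Context {R : realType}.
Implicit Types (X Y P : 'M[R]_2) (p q v : R * R).

Lemma free2P (vT : vectType R) (x y : vT) :
  reflect (forall k l : R, k *: x + l *: y = 0 -> k = 0 /\ l = 0)
    (free [:: x; y]).
Proof.
apply: (iffP (@freeP _ _ 2 [tuple x; y])) => [fr k l E|fr k E].
  have := fr (fun i => if i == 0 then k else l).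
  rewrite !big_ord_recl big_ord0 addr0 => /(_ E) H.
  by split; [have := H 0|have := H 1].
move: E; rewrite !big_ord_recl big_ord0 addr0 => /fr[k0 k1] i.
by case: (ord2P i) => ->; [exact: k0|rewrite -k1; congr k; exact: val_inj].
Qed.

(** As [Ad P] is linear and injective, a linear relation amounts to two scalar equations with
    determinant u2 v3 - v2 u3. *)
Lemma free_Ad_antidiag P (u2 u3 v2 v3 : R) : SL2 P ->
  free [:: Ad P (mx22 0 (2 * u2) (- 2 * u3) 0);
           Ad P (mx22 0 (2 * v2) (- 2 * v3) 0)] <->
  u2 * v3 - v2 * u3 <> 0.
Proof.
move=> SP.
have E k l : k *: Ad P (mx22 0 (2 * u2) (- 2 * u3) 0) +
    l *: Ad P (mx22 0 (2 * v2) (- 2 * v3) 0) = 0 <->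
    k * u2 + l * v2 = 0 /\ k * u3 + l * v3 = 0.
  rewrite -!AdZ -AdD !mx22E; split => [|[h2 h3]].
    rewrite -[X in _ = X](_ : Ad P 0 = 0); last by rewrite /Ad mulmx0 mul0mx.
    move/(Ad_inj _ SP); rewrite [X in _ = X]mx22_eta !mxE => /mx22_inj[_ h2 h3 _].
    by split; lra.
  rewrite [X in Ad _ X](_ : _ = 0) /Ad ?mulmx0 ?mul0mx//.
  rewrite [RHS]mx22_eta !mxE; congr mx22; lra.
split=> [/free2P fr D0|D0].
  (* If the determinant vanishes, (v2, -u2) and (v3, -u3) are coefficients of relations, so all four
     entries are 0; then (1, 0) is a nontrivial relation. *)
  have [v20 u20] : v2 = 0 /\ - u2 = 0 by apply: fr; apply/E; split; lra.
  have [v30 u30] : v3 = 0 /\ - u3 = 0 by apply: fr; apply/E; split; lra.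
  have [/eqP] : 1 = 0 :> R /\ 0 = 0 :> R; last by rewrite oner_eq0.
  by apply: fr; apply/E; split; lra.
apply/free2P => k l /E[h2 h3]; split; apply/eqP.
  (* Cramer's rule. *)
  have : k * (u2 * v3 - v2 * u3) == 0.
    rewrite [X in X == _](_ : _ = (k * u2 + l * v2) * v3 - (k * u3 + l * v3) * v2);
      last by ring.
    by rewrite h2 h3 !mul0r subrr.
  by rewrite mulf_eq0 => /orP[//|/eqP/D0].
have : l * (u2 * v3 - v2 * u3) == 0.
  rewrite [X in X == _](_ : _ = (k * u3 + l * v3) * u2 - (k * u2 + l * v2) * u3);
    last by ring.
  by rewrite h2 h3 !mul0r subrr.
by rewrite mulf_eq0 => /orP[//|/eqP/D0].
Qed.

(** * Commutators and scalar products in the frame *)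

Lemma dotM_mx22 (a b c d a' b' c' d' : R) :
  dotM (mx22 a b c d) (mx22 a' b' c' d') =
  - ((a * d' - b * c' - c * b' + d * a') / 2).
Proof. by rewrite /dotM mx22_bar mx22M mx22_tr; congr (- (_ / 2)); ring. Qed.

(** Since [e3] is diagonal, the commutator sees only the off-diagonal part of [X]. *)
Lemma commutator_e3 X :
  X *m e3 - e3 *m X = mx22 0 (2 * X 0 1) (- 2 * X 1 0) 0.
Proof.
by rewrite {1 2}[X]mx22_eta /e3 !mx22E; congr mx22; ring.
Qed.

Lemma sl2_mx22 X : bar_mx X = - X ->
  exists u1 u2 u3, X = mx22 u1 u2 u3 (- u1).
Proof.
rewrite [X in bar_mx X]mx22_eta mx22_bar => /(congr1 (fun Y => Y 0 0)).
by rewrite !mxE /= => h; exists (X 0 0), (X 0 1), (X 1 0); rewrite -h -mx22_eta.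
Qed.

Lemma dot_null1 (s : R) : dotM (s *: xi1) (s *: xi1) = 0.
Proof. by rewrite /xi1 mx22Z dotM_mx22; ring. Qed.

Lemma dot_null2 (s : R) : dotM (s *: xi2) (s *: xi2) = 0.
Proof. by rewrite /xi2 mx22Z dotM_mx22; ring. Qed.

Lemma dot_null12 (s t : R) : dotM (s *: xi1) (t *: xi2) = s * t / 2.
Proof. by rewrite /xi1 /xi2 !mx22Z dotM_mx22; field. Qed.

(** The product with [e3] is half the difference of the diagonal entries, so the multiple of [xi1]
    and the nilpotent square of [xi1] drop out. *)
Lemma dot_frame_xx (k s t x u2 u3 y : R) (X := mx22 x u2 u3 y) :
  dotM (k *: xi1 + s *: ((t *: xi1) *m xi1 + (X *m xi1 - xi1 *m X))) e3
  = - (s * u2).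
Proof. by rewrite /X /xi1 /e3 !mx22E dotM_mx22; field. Qed.

(** The summand [t / 2] comes from the product of [xi2] and [xi1], a diagonal matrix of rank one. *)
Lemma dot_frame_xy (k s t x u2 u3 y : R) (X := mx22 x u2 u3 y) :
  dotM (k *: xi1 + s *: ((t *: xi2) *m xi1 + (X *m xi1 - xi1 *m X))) e3
  = - (s * (t / 2 + u2)).
Proof. by rewrite /X /xi1 /xi2 /e3 !mx22E dotM_mx22; field. Qed.

Lemma dot_frame_yy (k s t x u2 u3 y : R) (X := mx22 x u2 u3 y) :
  dotM (k *: xi2 + s *: ((t *: xi2) *m xi2 + (X *m xi2 - xi2 *m X))) e3
  = s * u3.
Proof. by rewrite /X /xi2 /e3 !mx22E dotM_mx22; field. Qed.

(** Comparison of entries: the upper left one gives the first relation, which the lower right one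
    repeats, and the off-diagonal ones give [ds] and [dt]. *)
Lemma mixed_frame_eq (s t ds dt x y u2 u3 x' y' w2 w3 : R)
    (X := mx22 x u2 u3 y) (Y := mx22 x' w2 w3 y') :
  ds *: xi1 + s *: ((t *: xi2) *m xi1 + (Y *m xi1 - xi1 *m Y)) =
  dt *: xi2 + t *: ((s *: xi1) *m xi2 + (X *m xi2 - xi2 *m X)) ->
  [/\ s * t + s * w2 + t * u3 = 0, ds = s * (x' - y') & dt = t * (y - x)].
Proof.
rewrite /X /Y /xi1 /xi2 !(mx22M, mx22N, mx22D, mx22Z) => /mx22_inj[h1 h2 h3 _].
by split; lra.
Qed.

(** By the relation, M = - s (t/2 + w2) satisfies M + st/2 = - s w2 and M - st/2 = t u3, so that M^2
    - (st/2)^2 = - s t w2 u3. *)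
Lemma curvature_of_coefficients (s t u2 u3 w2 w3 : R) : s != 0 -> t != 0 ->
  s * t + s * w2 + t * u3 = 0 ->
  (- (s * u2) * (t * w3) - - (s * (t / 2 + w2)) * - (s * (t / 2 + w2))) /
  (0 * 0 - s * t / 2 * (s * t / 2)) - 1 = 4 * (u2 * w3 - w2 * u3) / (s * t).
Proof.
move=> sN0 tN0 h.
have -> : u3 = - (s * t + s * w2) / t.
  by apply: (mulfI tN0); rewrite mulrCA mulfV// mulr1; lra.
by field; rewrite sN0 tN0.
Qed.

Lemma gauss_curvature_coef (f N : R * R -> 'M[R]_2) p (L M P E G H : R) :
  dotM (partial_x (partial_x f) p) (N p) = L ->
  dotM (partial_y (partial_x f) p) (N p) = M ->
  dotM (partial_y (partial_y f) p) (N p) = P ->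
  dotM (partial_x f p) (partial_x f p) = E ->
  dotM (partial_x f p) (partial_y f p) = G ->
  dotM (partial_y f p) (partial_y f p) = H ->
  gauss_curvature f N p = (L * P - M * M) / (E * H - G * G) - 1.
Proof.
move=> <- <- <- <- <- <-.
by rewrite /gauss_curvature /II_mx /I_mx !mx22_det.
Qed.

(** * Structure equations of an adapted frame *)

Definition null_factor (omega : R * R -> R) (e : R) q : R :=
  e * expR (omega q / 2).

Lemma null_factor_neq0 (omega : R * R -> R) (e : R) q :
  e != 0 -> null_factor omega e q != 0.
Proof. by move=> e0; rewrite mulf_neq0// gt_eqF// expR_gt0. Qed.

Lemma is_derive_null_factor (A : set (R * R)) (omega : R * R -> R) (e : R) p v :
  smooth_on A omega -> A p ->
  is_derive p v (null_factor omega e)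
    (null_factor omega e p * ('D_v omega p / 2)).
Proof.
move=> smo Ap; have dom := smooth_on_is_derive A omega p v smo Ap.
have d2 : is_derive p v (fun q => omega q / 2) ('D_v omega p / 2).
  have D := is_deriveZ (2^-1 : R) dom.
  rewrite [X in is_derive _ _ X _](_ : _ = 2^-1 \*: omega); last first.
    by apply/funext => q; rewrite mulrC.
  by apply: is_derive_eq D _; rewrite mulrC.
have D := is_deriveZ e (is_derive_exp _ _ _ _ _ _ d2).
by apply: is_derive_eq D _; rewrite -mulrA.
Qed.

Context (A : set (R * R)%type) (oA : open A).
Context (f N F : R * R -> 'M[R]_2) (omega : R * R -> R) (e1 e2 : R).
Context (smf : smooth_on A f).
Context (smF : smooth_on A F).
Context (smo : smooth_on A omega).
Context (detf : forall p, A p -> \det (f p) = 1).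
Context (SF : forall p, A p -> SL2 (F p)).
Context (e1N0 : e1 != 0).
Context (e2N0 : e2 != 0).

Let a := null_factor omega e1.
Let b := null_factor omega e2.

Context (fx : forall p, A p ->
  partial_x f p = a p *: (f p *m Ad (F p) xi1)).
Context (fy : forall p, A p ->
  partial_y f p = b p *: (f p *m Ad (F p) xi2)).
Context (fN : forall p, A p -> N p = f p *m Ad (F p) e3).

Let ox : R * R -> R := partial_x omega.
Let oy : R * R -> R := partial_y omega.
Let U : R * R -> 'M[R]_2 := maurer_cartan F (1, 0).
Let W : R * R -> 'M[R]_2 := maurer_cartan F (0, 1).

Lemma fx_Ad p : A p -> partial_x f p = f p *m Ad (F p) (a p *: xi1).
Proof. by move=> Ap; rewrite fx// AdZ scalemxAr. Qed.

Lemma fy_Ad p : A p -> partial_y f p = f p *m Ad (F p) (b p *: xi2).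
Proof. by move=> Ap; rewrite fy// AdZ scalemxAr. Qed.

Lemma is_derive_fx p : A p -> is_derive p (1, 0) f (a p *: (f p *m Ad (F p) xi1)).
Proof. by move=> Ap; rewrite -fx//; exact: smooth_on_is_derive smf Ap. Qed.

Lemma is_derive_fy p : A p -> is_derive p (0, 1) f (b p *: (f p *m Ad (F p) xi2)).
Proof. by move=> Ap; rewrite -fy//; exact: smooth_on_is_derive smf Ap. Qed.

Lemma fxxE p : A p -> partial_x (partial_x f) p = f p *m Ad (F p)
  ((a p * (ox p / 2)) *: xi1 +
   a p *: ((a p *: xi1) *m xi1 + (U p *m xi1 - xi1 *m U p))).
Proof.
move=> Ap; exact: (derive2_frame A oA F smF SF f a _ _ _ _ _ _ _ Ap fx
  (is_derive_fx p Ap) (is_derive_null_factor _ _ _ _ _ smo Ap)).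
Qed.

Lemma fxyE p : A p -> partial_y (partial_x f) p = f p *m Ad (F p)
  ((a p * (oy p / 2)) *: xi1 +
   a p *: ((b p *: xi2) *m xi1 + (W p *m xi1 - xi1 *m W p))).
Proof.
move=> Ap; exact: (derive2_frame A oA F smF SF f a _ _ _ _ _ _ _ Ap fx
  (is_derive_fy p Ap) (is_derive_null_factor _ _ _ _ _ smo Ap)).
Qed.

Lemma fyxE p : A p -> partial_x (partial_y f) p = f p *m Ad (F p)
  ((b p * (ox p / 2)) *: xi2 +
   b p *: ((a p *: xi1) *m xi2 + (U p *m xi2 - xi2 *m U p))).
Proof.
move=> Ap; exact: (derive2_frame A oA F smF SF f b _ _ _ _ _ _ _ Ap fy
  (is_derive_fx p Ap) (is_derive_null_factor _ _ _ _ _ smo Ap)).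
Qed.

Lemma fyyE p : A p -> partial_y (partial_y f) p = f p *m Ad (F p)
  ((b p * (oy p / 2)) *: xi2 +
   b p *: ((b p *: xi2) *m xi2 + (W p *m xi2 - xi2 *m W p))).
Proof.
move=> Ap; exact: (derive2_frame A oA F smF SF f b _ _ _ _ _ _ _ Ap fy
  (is_derive_fy p Ap) (is_derive_null_factor _ _ _ _ _ smo Ap)).
Qed.

(* Integrability of f, that is, the equality of its mixed derivatives. *)
Lemma frame_coefficients p : A p -> exists u2 u3 w2 w3,
  [/\ U p = mx22 (- ox p / 4) u2 u3 (ox p / 4),
      W p = mx22 (oy p / 4) w2 w3 (- oy p / 4) &
      a p * b p + a p * w2 + b p * u3 = 0].
Proof.
move=> Ap.
have uf : f p \in unitmx by rewrite unitmxE (detf p Ap) unitr1.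
have [u1 [u2 [u3 HU]]] : exists u1 u2 u3, U p = mx22 u1 u2 u3 (- u1).
  exact: sl2_mx22 _ (maurer_cartan_sl2 A oA F smF SF (1, 0) p Ap).
have [w1 [w2 [w3 HW]]] : exists w1 w2 w3, W p = mx22 w1 w2 w3 (- w1).
  exact: sl2_mx22 _ (maurer_cartan_sl2 A oA F smF SF (0, 1) p Ap).
have C := smooth_on_mx_deriveC A oA _ _ f (1, 0) (0, 1) p smf Ap.
(* The two expressions of the mixed derivative are compared after stripping the invertible [f p] and
   [Ad (F p)]. *)
have := Ad_inj _ (SF p Ap) _ _ (can_inj (mulKmx uf)
  (etrans (esym (fxyE p Ap)) (etrans C (fyxE p Ap)))).
rewrite HU HW => /mixed_frame_eq[h1 h2 h3] {C}.
exists u2, u3, w2, w3.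
have aN0 : a p != 0 := null_factor_neq0 _ _ p e1N0.
have bN0 : b p != 0 := null_factor_neq0 _ _ p e2N0.
(* The off-diagonal equations read b omega_x / 2 = - 2 b u1 and a omega_y / 2 = 2 a w1. *)
have -> : u1 = - ox p / 4 by apply: (mulfI bN0); lra.
have -> : w1 = oy p / 4 by apply: (mulfI aN0); lra.
by split; [congr mx22; lra|congr mx22; lra|lra].
Qed.

(* Integrability of F: the diagonal entry of the Maurer-Cartan equation. *)
Lemma omega_xyE p u2 u3 w2 w3 : A p ->
  U p = mx22 (- ox p / 4) u2 u3 (ox p / 4) ->
  W p = mx22 (oy p / 4) w2 w3 (- oy p / 4) ->
  partial_y (partial_x omega) p = - 2 * (u2 * w3 - w2 * u3).
Proof.
have lin (c d : R) : - 4^-1 * c - 4^-1 * c = d -> c = - 2 * d by lra.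
move=> Ap HU HW.
have sx := smooth_on_derive A omega (1, 0) smo.
have sy := smooth_on_derive A omega (0, 1) smo.
have near_omega v : \forall q \near p, is_derive q v omega ('D_v omega q).
  apply: filterS (near_open A oA p Ap) => q Aq.
  exact: smooth_on_is_derive smo Aq.
have oC : partial_y ox p = partial_x oy p.
  exact: deriveC _ _ _ _ _ _ _ _ (near_omega (1, 0)) (near_omega (0, 1))
    (smooth_on_differentiable A _ p sx Ap) (smooth_on_differentiable A _ p sy Ap).
have scaled (g : R * R -> R) (c : R) v : smooth_on A g ->
    is_derive p v (fun q => c * g q) (c * 'D_v g p).
  by move=> sg; exact: is_deriveZ (smooth_on_is_derive A g p v sg Ap).
(* The formula for the diagonal of [U] holds on a neighbourhood of [p], so it may be
   differentiated. *)
have Uy : 'D_(0, 1) U p 0 0 = - 4^-1 * partial_y ox p.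
  have [D _] := is_derive_maurer_cartan A oA F smF SF (1, 0) (0, 1) p Ap.
  have [_ <-] := (is_derive_mxP _ _ _ _ _ _ _ _).1 (derivableP D) 0 0.
  have [_ <-] := scaled ox (- 4^-1) (0, 1) sx.
  apply: near_eq_derive; apply: filterS (near_open A oA p Ap) => q Aq.
  have [? [? [? [? [Uq _ _]]]]] := frame_coefficients q Aq.
  by rewrite -/(U q) Uq mxE /=; lra.
have Wx : 'D_(1, 0) W p 0 0 = 4^-1 * partial_y ox p.
  rewrite oC.
  have [D _] := is_derive_maurer_cartan A oA F smF SF (0, 1) (1, 0) p Ap.
  have [_ <-] := (is_derive_mxP _ _ _ _ _ _ _ _).1 (derivableP D) 0 0.
  have [_ <-] := scaled oy (4^-1) (1, 0) sy.
  apply: near_eq_derive; apply: filterS (near_open A oA p Ap) => q Aq.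
  have [? [? [? [? [_ Wq _]]]]] := frame_coefficients q Aq.
  by rewrite -/(W q) Wq mxE /=; lra.
have MC : 'D_(0, 1) U p - 'D_(1, 0) W p = U p *m W p - W p *m U p.
  exact: maurer_cartan_eq A oA F smF SF (1, 0) (0, 1) p Ap.
have sub00 X Y : (X - Y) 0 0 = X 0 0 - Y 0 0 by rewrite !mxE.
(* In the upper left entry of the commutator the products of diagonal entries cancel. *)
have D00 : 'D_(0, 1) U p 0 0 - 'D_(1, 0) W p 0 0 = u2 * w3 - w2 * u3.
  by rewrite -sub00 MC HU HW !mx22E mxE /=; ring.
have E : - 4^-1 * partial_y ox p - 4^-1 * partial_y ox p = u2 * w3 - w2 * u3.
  exact: etrans (congr2 (fun s t => s - t) (esym Uy) (esym Wx)) D00.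
exact: lin E.
Qed.

(** The coefficients of both fundamental forms are evaluated in the frame through the isometry
    [dotM_Ad]. *)
Lemma gauss_curvatureE p u2 u3 w2 w3 : A p ->
  U p = mx22 (- ox p / 4) u2 u3 (ox p / 4) ->
  W p = mx22 (oy p / 4) w2 w3 (- oy p / 4) ->
  a p * b p + a p * w2 + b p * u3 = 0 ->
  gauss_curvature f N p = 4 * (u2 * w3 - w2 * u3) / (a p * b p).
Proof.
move=> Ap HU HW h.
have dotA X Y := dotM_Ad _ _ X Y (detf p Ap) (SF p Ap).
have dfx2 : dotM (partial_x f p) (partial_x f p) = 0.
  by rewrite fx_Ad// dotA dot_null1.
have dfy2 : dotM (partial_y f p) (partial_y f p) = 0.
  by rewrite fy_Ad// dotA dot_null2.
have dfxy : dotM (partial_x f p) (partial_y f p) = a p * b p / 2.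
  by rewrite fx_Ad// fy_Ad// dotA dot_null12.
have Lxx := etrans (congr2 dotM (fxxE p Ap) (fN p Ap)) (dotA _ _).
have Lxy := etrans (congr2 dotM (fxyE p Ap) (fN p Ap)) (dotA _ _).
have Lyy := etrans (congr2 dotM (fyyE p Ap) (fN p Ap)) (dotA _ _).
rewrite HU dot_frame_xx in Lxx; rewrite HW dot_frame_xy in Lxy.
rewrite HW dot_frame_yy in Lyy.
rewrite (gauss_curvature_coef _ _ _ _ _ _ _ _ _ Lxx Lxy Lyy dfx2 dfxy dfy2).
exact: curvature_of_coefficients (null_factor_neq0 _ _ p e1N0)
  (null_factor_neq0 _ _ p e2N0) h.
Qed.

(** Near [p] the Gauss map equals Ad_F e3, so its derivatives are Ad_F of commutators with [e3]. *)
Lemma gauss_map_immersion p u2 u3 w2 w3 x y x' y' : A p ->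
  U p = mx22 x u2 u3 y -> W p = mx22 x' w2 w3 y' ->
  immersion_at (gauss_map f N) p <-> u2 * w3 - w2 * u3 <> 0.
Proof.
move=> Ap HU HW; rewrite -(free_Ad_antidiag (F p)); last exact: SF.
have D v : 'D_v (gauss_map f N) p =
    Ad (F p) (maurer_cartan F v p *m e3 - e3 *m maurer_cartan F v p).
  have [_ <-] := is_derive_Ad A oA F smF SF e3 v p Ap.
  apply: near_eq_derive; apply: filterS (near_open A oA p Ap) => q Aq.
  rewrite /gauss_map (fN q Aq) mulKmx//.
  by rewrite unitmxE (detf q Aq) unitr1.
have Dx : partial_x (gauss_map f N) p = Ad (F p) (mx22 0 (2 * u2) (- 2 * u3) 0).
  by apply: etrans (D (1, 0)) _; rewrite -/(U p) HU commutator_e3 !mxE.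
have Dy : partial_y (gauss_map f N) p = Ad (F p) (mx22 0 (2 * w2) (- 2 * w3) 0).
  by apply: etrans (D (0, 1)) _; rewrite -/(W p) HW commutator_e3 !mxE.
by rewrite /immersion_at Dx Dy.
Qed.

End AdaptedFrame.

(** * Comparison of the three conditions *)

Theorem proposition3p4 (R : realType) (Omega : set (R * R)%type)
  (f N F : R * R -> 'M[R]_2) (omega : R * R -> R) (eps : R)
  (hOmega : domain Omega)
  (hf : timelike_immersion Omega f)
  (hnull : null_coordinates Omega f)
  (heps : is_sign eps)
  (homega : smooth_on Omega omega)
  (hconf : forall p, Omega p ->
     2 * dotM (partial_x f p) (partial_y f p) = eps * expR (omega p))
  (hN : unit_normal Omega f N)
  (hF : adapted_frame Omega f N omega eps F) :
  forall p, Omega p ->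
    (gauss_curvature f N p <> 0 <-> partial_y (partial_x omega) p <> 0) /\
    (partial_y (partial_x omega) p <> 0 <-> immersion_at (gauss_map f N) p).
Proof.
move=> p Op.
have [oO _] := hOmega.
have [smF SF [e1 [e2 [s1 s2 _ frame]]]] := hF.
have [smf AdSf _ _] := hf.
have detf q : Omega q -> \det (f q) = 1 by move=> /AdSf/AdS3_det.
have fE q (X Y : 'M[R]_2) : Omega q -> invmx (f q) *m X = Y -> X = f q *m Y.
  by move=> Oq <-; rewrite mulKVmx// unitmxE (detf q Oq) unitr1.
have fx q : Omega q ->
    partial_x f q = (e1 * expR (omega q / 2)) *: (f q *m Ad (F q) xi1).
  move=> Oq; have [h _ _] := frame q Oq.
  exact: etrans (fE _ _ _ Oq h) (esym (scalemxAr _ _ _)).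
have fy q : Omega q ->
    partial_y f q = (e2 * expR (omega q / 2)) *: (f q *m Ad (F q) xi2).
  move=> Oq; have [_ h _] := frame q Oq.
  exact: etrans (fE _ _ _ Oq h) (esym (scalemxAr _ _ _)).
have fN q : Omega q -> N q = f q *m Ad (F q) e3.
  by move=> Oq; have [] := frame q Oq.
have signN0 (e : R) : is_sign e -> e != 0 by case=> ->; rewrite ?oppr_eq0 oner_neq0.
have e1N0 := signN0 _ s1; have e2N0 := signN0 _ s2.
have [u2 [u3 [w2 [w3 [HU HW h]]]]] :=
  frame_coefficients Omega oO f F omega e1 e2 smf smF homega detf SF e1N0 e2N0
    fx fy p Op.
have oE := omega_xyE Omega oO f F omega e1 e2 smf smF homega detf SF e1N0 e2N0
  fx fy p _ _ _ _ Op HU HW.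
have KE := gauss_curvatureE Omega oO f N F omega e1 e2 smf smF homega detf SF
  e1N0 e2N0 fx fy fN p _ _ _ _ Op HU HW h.
have immE := gauss_map_immersion Omega oO f N F smF detf SF fN p _ _ _ _ _ _ _ _
  Op HU HW.
have abN0 := mulf_neq0 (null_factor_neq0 omega e1 p e1N0)
  (null_factor_neq0 omega e2 p e2N0).
(* With [D] abstracted, each of the three conditions is compared with [D <> 0]. *)
move: (u2 * w3 - w2 * u3) oE KE immE => D oE KE immE.
have oN0 : partial_y (partial_x omega) p <> 0 <-> D <> 0.
  by rewrite oE; split=> H E; apply: H; lra.
have KN0 : gauss_curvature f N p <> 0 <-> D <> 0.
  rewrite KE; split=> H E; apply: H; first by rewrite E mulr0 mul0r.
  move/eqP: E; rewrite mulf_eq0 invr_eq0 (negPf abN0) orbF mulf_eq0.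
  by rewrite pnatr_eq0 => /eqP.
by rewrite oN0 KN0 immE.
Qed.
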